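(* Let $m,n\geq2$, let $\mathbf p\in\mathbb R^m$, $\mathbf q\in\mathbb R^n$ be probability vectors with all entries strictly positive, and let $\Psi$ be a strict Schur-concave function on $\mathcal C(\mathbf p,\mathbf q)$. Then all minimal value points of $\Psi$ lie in $\mathscr C(\mathbf p,\mathbf q)$, and $$\inf_{P\in\mathcal C(\mathbf p,\mathbf q)}\Psi(P)=\min_{P\in\mathscr C(\mathbf p,\mathbf q)}\Psi(P),$$ where $\mathscr C(\mathbf p,\mathbf q)=\mathcal C_e(\mathbf p,\mathbf q)$ is the set of extreme points of $\mathcal C(\mathbf p,\mathbf q)$.
   Context: $\mathcal C(\mathbf p,\mathbf q)$: nonnegative $m\times n$ matrices with row sums $p_i$, column sums $q_j$, viewed as vectors in $\mathbb R^{mn}$; $\mathcal C_e(\mathbf p,\mathbf q)$: its extreme points; $V(P)=\{(i,j):p_{i,j}\ne0\}$. $\mathscr C(\mathbf p,\mathbf q)$: the set of $P\in\mathcal C(\mathbf p,\mathbf q)$ with $V(P)\subset T$ for some tree $T\subset[m]\times[n]$ with $|T|=m+n-1$ (graph notions: distinct points adjacent iff they share a row or column; a circuit is a cyclic sequence of $s\ge4$ pairwise distinct points $v_k=(i_k,j_k)$ with, indices mod $s$, $v_k,v_{k+1}$ adjacent and $(i_{k+2}-i_k)(j_{k+2}-j_k)\ne0$; a tree is a connected subset with no circuit). Majorization: for $x,y\in\mathbb R^N$ let $\bar x,\bar y$ be the decreasing rearrangements and $F_{\bar x}(i)=\sum_{k\le i}\bar x_k$; $x\preceq y$ if $F_{\bar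 x}(i)\le F_{\bar y}(i)$ for $1\le i<N$ and $F_{\bar x}(N)=F_{\bar y}(N)$; $x\prec y$ if moreover $F_{\bar x}(i)<F_{\bar y}(i)$ for some $i<N$. $\Psi$ (symmetric in the entries) is Schur-concave if $x\preceq y$ implies $\Psi(x)\ge\Psi(y)$, and strict Schur-concave if moreover $x\prec y$ implies $\Psi(x)>\Psi(y)$. *)

(* Defs.v *)
From HB Require Import structures.
From mathcomp Require Import all_boot all_order all_algebra.
From mathcomp Require Import reals.
From mathcomp Require Import fingroup perm.
Set Implicit Arguments. Unset Strict Implicit. Unset Printing Implicit Defensive.
Import Order.TTheory GRing.Theory Num.Theory.
Local Open Scope ring_scope.

Section Defs.
Variable R : realType.
Variables m n : nat.
Notation pt := ('I_m * 'I_n)%type.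

Definition entries (A : 'M[R]_(m, n)) : seq R :=
  [seq A ij.1 ij.2 | ij <- enum {: pt}].

Definition decr (s : seq R) : seq R := sort (fun a b => b <= a) s.
Definition Fsum (s : seq R) (k : nat) : R := \sum_(x <- take k (decr s)) x.

Definition majorized (x y : seq R) : Prop :=
  size x = size y /\
  (forall k, (1 <= k < size x)%N -> Fsum x k <= Fsum y k) /\
  Fsum x (size x) = Fsum y (size y).

Definition strictly_majorized (x y : seq R) : Prop :=
  majorized x y /\ exists k, (1 <= k < size x)%N /\ Fsum x k < Fsum y k.

Definition transport (p : 'I_m -> R) (q : 'I_n -> R) (P : 'M[R]_(m, n)) : Prop :=
  (forall i j, 0 <= P i j) /\
  (forall i, \sum_(j < n) P i j = p i) /\
  (forall j, \sum_(i < m) P i j = q j).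

Definition extreme_point (p : 'I_m -> R) (q : 'I_n -> R) (P : 'M[R]_(m, n)) : Prop :=
  transport p q P /\
  forall (A B : 'M[R]_(m, n)) (t : R), transport p q A -> transport p q B ->
    0 < t < 1 -> P = t *: A + (1 - t) *: B -> A = B.

Definition support_mx (P : 'M[R]_(m, n)) : {set pt} :=
  [set ij : pt | P ij.1 ij.2 != 0].

Definition adjacent : rel pt :=
  fun u v => (u != v) && ((u.1 == v.1) || (u.2 == v.2)).

Definition connected_set (T : {set pt}) : Prop :=
  forall u v, u \in T -> v \in T ->
    exists s : seq pt, [/\ path adjacent u s, all (fun x => x \in T) s & last u s = v].

Definition circuit_in (T : {set pt}) (N : nat) (v : nat -> pt) : Prop :=
  [/\ (4 <= N)%N,
      forall k, (k < N)%N -> v k \in T,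
      forall a b, (a < N)%N -> (b < N)%N -> v a = v b -> a = b,
      forall k, (k < N)%N -> adjacent (v k) (v ((k + 1) %% N)%N) &
      forall k, (k < N)%N ->
        ((v ((k + 2) %% N)%N).1 != (v k).1) /\ ((v ((k + 2) %% N)%N).2 != (v k).2)].

Definition tree (T : {set pt}) : Prop :=
  connected_set T /\ ~ (exists N v, circuit_in T N v).

Definition tree_supported (p : 'I_m -> R) (q : 'I_n -> R) (P : 'M[R]_(m, n)) : Prop :=
  transport p q P /\
  exists T : {set pt}, [/\ support_mx P \subset T, tree T & #|T| = (m + n).-1].

End Defs.

(* Main.v *)
(**
Call a set of cells cycle-free if it supports no nonzero matrix with vanishing
row and column sums.  A transport matrix is extreme exactly when its support is
cycle-free, and cycle-freeness of [T] means that the rows [e_i + f_j], [(i, j)]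
in [T], of the incidence matrix are independent.  A connected [T] meeting every
line, like a maximal cycle-free [T], makes these rows span a space of dimension
[m + n - 1]: this matches cycle-free sets with subsets of trees.

For the minimum, let [a] be a largest entry of a submatrix, in cell [(i, j)], and
[x], [y] positive entries in its row and column.  Moving mass [min x y] around
the square formed by these three cells and the fourth corner (whose entry may
be zero) strictly increases the matrix for majorization.  Repeating this leaves
[(i, j)] alone in its row or column, which is then deleted; so every transport
matrix is either cycle-free or strictly majorized by a cycle-free one.
*)
Require Import Defs.
From HB Require Import structures.
From mathcomp Require Import all_boot all_order all_algebra.
From mathcomp Require Import reals boolp.
From mathcomp Require Import fingroup perm.
From mathcomp Require Import ring lra zify.
Import Order.TTheory GRing.Theory Num.Theory.
Local Open Scope ring_scope.

(** * Majorization through hinge sums *)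

(* Together with [Fsum_eq_hinge]: [Fsum s k] is the minimum over [t] of
   [k t + sum (x - t)^+], which turns majorization into hinge inequalities. *)
Lemma Fsum_le_hinge {R : realType} (s : seq R) (k : nat) (t : R) :
  (k <= size s)%N -> Fsum s k <= t *+ k + \sum_(x <- s) Num.max 0 (x - t).
Proof.
move=> ks; rewrite /Fsum.
have -> : \sum_(x <- s) Num.max 0 (x - t) = \sum_(x <- decr s) Num.max 0 (x - t).
  by apply: perm_big; rewrite perm_sym perm_sort.
rewrite -{2}(cat_take_drop k (decr s)) big_cat /=.
have -> : t *+ k = \sum_(x <- take k (decr s)) t.
  rewrite big_const_seq count_predT size_takel ?size_sort //.
  by rewrite iter_addr_0.
rewrite addrA -big_split /= -[leLHS]addr0 lerD //.
- by apply: ler_sum => x _; rewrite -lerBlDl le_max lexx orbT.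
- by apply: sumr_ge0 => x _; rewrite le_max lexx.
Qed.

Lemma Fsum_eq_hinge {R : realType} (s : seq R) (k : nat) :
  (0 < k <= size s)%N ->
  exists t, Fsum s k = t *+ k + \sum_(x <- s) Num.max 0 (x - t).
Proof.
(* The optimal [t] is the smallest of the retained entries: each of these contributes exactly
   [x - t], and the dropped ones, being at most [t], contribute 0. *)
case: k => // k ks; exists (nth 0 (decr s) k); set t := nth _ _ _.
have srt : sorted (fun a b : R => b <= a) (decr s).
  by apply: sort_sorted => a b; apply: le_total.
have szs : size (decr s) = size s by rewrite size_sort.
have mono a b : (a <= b)%N -> (b < size s)%N -> nth 0 (decr s) b <= nth 0 (decr s) a.
  move=> ab bs; apply: (sorted_leq_nth _ _ 0 srt); rewrite ?inE ?szs //.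
  - by move=> y x z xy yz; apply: le_trans yz xy.
  - exact: leq_ltn_trans bs.
rewrite /Fsum.
have -> : \sum_(x <- s) Num.max 0 (x - t) = \sum_(x <- decr s) Num.max 0 (x - t).
  by apply: perm_big; rewrite perm_sym perm_sort.
rewrite -{2}(cat_take_drop k.+1 (decr s)) big_cat /=.
rewrite [X in _ + (_ + X)]big1_seq => [|x /andP[_ /(nthP 0)[a]]]; last first.
  rewrite size_drop szs ltn_subRL nth_drop => la <-.
  by apply/max_idPl; rewrite subr_le0; apply: mono => //; rewrite ltnW // leq_addr.
have -> : t *+ k.+1 = \sum_(x <- take k.+1 (decr s)) t.
  rewrite big_const_seq count_predT size_takel ?szs //.
  by rewrite iter_addr_0.
rewrite addr0 -big_split /=; apply: eq_big_seq => x /(nthP 0)[a].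
rewrite size_takel ?szs // => ak <-; rewrite nth_take //.
have := mono a k ak ks; rewrite -/t => h.
by rewrite max_r ?subr_ge0 // addrC subrK.
Qed.

Lemma Fsum_size {R : realType} (s : seq R) : Fsum s (size s) = \sum_(x <- s) x.
Proof.
rewrite /Fsum take_oversize ?size_sort //.
by apply: perm_big; rewrite perm_sort.
Qed.

(** Successive differences of [Fsum] recover the sorted sequence entry by entry. *)
Lemma Fsum_inj_perm {R : realType} (x y : seq R) : size x = size y ->
  (forall k, (k <= size x)%N -> Fsum x k = Fsum y k) -> perm_eq x y.
Proof.
move=> sxy eF; suff e : decr x = decr y.
  by rewrite -(perm_sort (fun a b : R => b <= a)) -/(decr x) e perm_sort.
have sx : size (decr x) = size x by rewrite size_sort.
have sy : size (decr y) = size x by rewrite size_sort.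
apply: (@eq_from_nth _ 0); rewrite ?sx ?sy // => k kx.
have Fk (s : seq R) : size (decr s) = size x ->
    nth 0 (decr s) k = Fsum s k.+1 - Fsum s k.
  move=> ss; rewrite /Fsum (take_nth 0) ?ss // -cats1 big_cat big_seq1 /=.
  by rewrite addrAC subrr add0r.
by rewrite !Fk // !eF // ltnW.
Qed.

(* The last hypothesis only serves to exclude that [y] is a permutation of [x]. *)
Lemma strictly_majorized_hinge {R : realType} (x y : seq R) (h : R -> R) :
  size x = size y -> \sum_(a <- x) a = \sum_(a <- y) a ->
  (forall t, \sum_(a <- x) Num.max 0 (a - t) <= \sum_(a <- y) Num.max 0 (a - t)) ->
  \sum_(a <- x) h a != \sum_(a <- y) h a ->
  strictly_majorized x y.
Proof.
move=> sxy e1 hinge hne.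
have eN : Fsum x (size x) = Fsum y (size y) by rewrite !Fsum_size.
have le k : (1 <= k < size x)%N -> Fsum x k <= Fsum y k.
  (* The [t] that is optimal for [y] still gives an upper bound for [x]. *)
  move=> /andP[k0 kx]; have [|t ->] := @Fsum_eq_hinge _ y k.
    by rewrite k0 -sxy ltnW.
  by apply: le_trans (@Fsum_le_hinge _ x k t (ltnW kx)) _; rewrite lerD2l.
split; first exact: (conj sxy (conj le eN)).
(* With no strict index all partial sums agree, so [x] and [y] are permutations of each other and
   have the same sum of [h]. *)
apply: contrapT => nex; case/eqP: hne; apply: perm_big.
apply: Fsum_inj_perm => // k; rewrite leq_eqVlt => /orP[/eqP->|kx]; first by rewrite eN sxy.
case: k kx => [|k] kx; first by rewrite /Fsum !take0 !big_nil.
apply/eqP; rewrite eq_le le //= leNgt; apply/negP => lt; apply: nex.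
by exists k.+1.
Qed.

(** Convexity of the hinge: [u] and [v] lie between [lo] and [hi] and have the same sum, so
    spreading them apart cannot lower the total. *)
Lemma hinge_spread {R : realType} (u v lo hi t : R) :
  lo <= u -> lo <= v -> u + v = hi + lo ->
  Num.max 0 (u - t) + Num.max 0 (v - t) <= Num.max 0 (hi - t) + Num.max 0 (lo - t).
Proof.
move=> lu lv e.
case: (leP 0 (u - t)); case: (leP 0 (v - t)); case: (leP 0 (hi - t));
  case: (leP 0 (lo - t)); lra.
Qed.

(** * Shifting mass around a square *)

Lemma sum_supp2 {R : realType} {I : finType} (i i' : I) (F : I -> R) : i != i' ->
  (forall k, k != i -> k != i' -> F k = 0) -> \sum_k F k = F i + F i'.
Proof.
move=> ii F0; rewrite (bigD1 i) //= (bigD1 i') 1?eq_sym //= big1 ?addr0 // => k.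
by case/andP; exact: F0.
Qed.

Lemma big_entries {R : realType} {m n : nat} (P : 'M[R]_(m, n)) (f : R -> R) :
  \sum_(a <- entries P) f a = \sum_i \sum_j f (P i j).
Proof. by rewrite big_map big_enum /= pair_bigA. Qed.

Definition square_cycle (R : realType) {m n : nat} (i i' : 'I_m) (j j' : 'I_n) : 'M[R]_(m, n) :=
  \matrix_(k, l) (((k == i)%:R - (k == i')%:R) * ((l == j)%:R - (l == j')%:R)).

(** The directions along which a matrix can move without changing its row and column sums. *)
Definition margins0 {R : realType} {m n : nat} (D : 'M[R]_(m, n)) : Prop :=
  (forall i, \sum_j D i j = 0) /\ (forall j, \sum_i D i j = 0).

Lemma sum_delta {R : realType} {I : finType} (i : I) : \sum_k (k == i)%:R = 1 :> R.
Proof. by rewrite (bigD1 i) //= eqxx big1 ?addr0 // => k /negbTE ->. Qed.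

Lemma square_cycle_margins0 (R : realType) (m n : nat) (i i' : 'I_m) (j j' : 'I_n) :
  margins0 (square_cycle R i i' j j').
Proof.
split=> k.
- under eq_bigr do rewrite mxE.
  by rewrite -mulr_sumr sumrB !sum_delta subrr mulr0.
- under eq_bigr do rewrite mxE.
  by rewrite -mulr_suml sumrB !sum_delta subrr mul0r.
Qed.

Lemma transport_add {R : realType} {m n : nat} {p : 'I_m -> R} {q : 'I_n -> R}
    {P D : 'M[R]_(m, n)} (c : R) :
  transport p q P -> margins0 D -> (forall i j, 0 <= (P + c *: D) i j) ->
  transport p q (P + c *: D).
Proof.
move=> [_ [Pr Pc]] [Dr Dc] ge0; split=> //; split=> k.
- under eq_bigr do rewrite !mxE.
  by rewrite big_split /= -mulr_sumr Dr mulr0 addr0.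
- under eq_bigr do rewrite !mxE.
  by rewrite big_split /= -mulr_sumr Dc mulr0 addr0.
Qed.

Lemma add_square_cycle {R : realType} {m n : nat} (P : 'M[R]_(m, n)) (c : R)
    {i i' : 'I_m} {j j' : 'I_n} :
  i' != i -> j' != j ->
  let Q := P + c *: square_cycle R i i' j j' in
  [/\ Q i j = P i j + c, Q i j' = P i j' - c, Q i' j = P i' j - c
    & Q i' j' = P i' j' + c] /\
  (forall k l, k != i -> k != i' -> Q k l = P k l) /\
  (forall k l, l != j -> l != j' -> Q k l = P k l).
Proof.
move=> /negbTE ii /negbTE jj Q.
have ii' : (i == i') = false by rewrite eq_sym.
have jj' : (j == j') = false by rewrite eq_sym.
split; first by split; rewrite !mxE !eqxx ?ii ?ii' ?jj ?jj' /=; ring.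
by split=> k l /negbTE h /negbTE h'; rewrite !mxE h h' /=; ring.
Qed.

(** The four corners split into two pairs, each spread apart with its sum kept, so every hinge sum
    weakly grows; the sum of squares grows strictly. *)
Lemma shift_strictly_majorizes {R : realType} {m n : nat} {p : 'I_m -> R} {q : 'I_n -> R}
    {P : 'M[R]_(m, n)} (i i' : 'I_m) (j j' : 'I_n) :
  transport p q P -> i' != i -> j' != j ->
  P i j' <= P i j -> P i' j <= P i j -> 0 < P i j' -> 0 < P i' j ->
  let Q := P + Num.min (P i j') (P i' j) *: square_cycle R i i' j j' in
  transport p q Q /\ strictly_majorized (entries P) (entries Q).
Proof.
move=> tP ii jj xa ya x0 y0; set c := Num.min _ _ => Q.
have c0 : 0 < c by rewrite lt_min x0.
have cx : c <= P i j' by rewrite ge_min lexx.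
have cy : c <= P i' j by rewrite ge_min lexx orbT.
have cxy : c = P i j' \/ c = P i' j by rewrite /c; case: leP; [left|right].
have d0 : 0 <= P i' j' by case: tP.
have [[Qa Qx Qy Qd] [Qrow Qcol]] := add_square_cycle P c ii jj.
rewrite -/Q in Qa Qx Qy Qd Qrow Qcol.
have tQ : transport p q Q.
  apply: transport_add => //; first exact: square_cycle_margins0.
  move=> k l; rewrite -/Q; have Pge0 : 0 <= P k l by case: tP.
  have [->|ki] := eqVneq k i; have [->|lj] := eqVneq l j.
  - by rewrite Qa; lra.
  - by have [->|lj'] := eqVneq l j'; [rewrite Qx; lra | rewrite Qcol //; case: tP].
  - by have [->|ki'] := eqVneq k i'; [rewrite Qy; lra | rewrite Qrow //; case: tP].
  - have [ki'|ki'] := eqVneq k i'; last by rewrite Qrow.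
    have [lj'|lj'] := eqVneq l j'; last by rewrite Qcol.
    by rewrite ki' lj' Qd; lra.
split=> //.
(* Only the four corners change. This identity is used for the identity map, the hinges and the
   square. *)
have dif (f : R -> R) : \sum_(a <- entries Q) f a - \sum_(a <- entries P) f a =
    (f (P i j + c) - f (P i j) + (f (P i j' - c) - f (P i j'))) +
    (f (P i' j - c) - f (P i' j) + (f (P i' j' + c) - f (P i' j'))).
  rewrite !big_entries -sumrB; under eq_bigr do rewrite -sumrB.
  rewrite (@sum_supp2 _ _ i i') 1?eq_sym //; last first.
    by move=> k ki ki'; rewrite big1 // => l _; rewrite Qrow ?subrr.
  rewrite !(@sum_supp2 _ _ j j') 1?eq_sym //; last 2 first.
  - by move=> l lj lj'; rewrite Qcol ?subrr.
  - by move=> l lj lj'; rewrite Qcol ?subrr.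
  by rewrite Qa Qx Qy Qd.
apply: (@strictly_majorized_hinge _ _ _ (fun a => a ^+ 2)).
- by rewrite !size_map.
- by apply/eqP; rewrite eq_sym -subr_eq0 (dif id); apply/eqP; ring.
- move=> t; rewrite -subr_ge0 (dif (fun a => Num.max 0 (a - t))).
  (* The fourth corner is paired with the neighbour that drops to 0, because then nonnegativity puts
     it above the lower end; the largest entry is paired with the other neighbour. *)
  case: cxy => e.
  + have := @hinge_spread _ (P i j) (P i' j) (P i' j - c) (P i j + c) t.
    have := @hinge_spread _ (P i' j') (P i j') (P i j' - c) (P i' j' + c) t.
    move=> h1 h2; have := h1 ltac:(lra) ltac:(lra) ltac:(lra).
    by have := h2 ltac:(lra) ltac:(lra) ltac:(lra); lra.
  + have := @hinge_spread _ (P i j) (P i j') (P i j' - c) (P i j + c) t.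
    have := @hinge_spread _ (P i' j') (P i' j) (P i' j - c) (P i' j' + c) t.
    move=> h1 h2; have := h1 ltac:(lra) ltac:(lra) ltac:(lra).
    by have := h2 ltac:(lra) ltac:(lra) ltac:(lra); lra.
(* If [c = x], the last factor below is [x + (a - y) + d], which is positive; the case [c = y] is
   symmetric. *)
- rewrite eq_sym -subr_eq0 (dif (fun a => a ^+ 2)) gt_eqF //.
  have -> : forall a x y d : R, (a + c) ^+ 2 - a ^+ 2 + ((x - c) ^+ 2 - x ^+ 2) +
      ((y - c) ^+ 2 - y ^+ 2 + ((d + c) ^+ 2 - d ^+ 2)) = 2 * c * (2 * c + a - x - y + d).
    by move=> *; ring.
  by rewrite mulr_gt0 //; case: cxy; lra.
Qed.

(** * Descent to a cycle-free support *)

(** Acyclicity in linear form: in the bipartite graph of rows and columns with edge set [T], no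
    nonzero edge weighting sums to 0 at every vertex. *)
Definition cycle_free {R : realType} {m n : nat} (T : {set 'I_m * 'I_n}) : Prop :=
  forall D : 'M[R]_(m, n), margins0 D ->
    (forall i j, D i j != 0 -> (i, j) \in T) -> D = 0.

(** Induction on the number of nonzero entries in the row and column of [(i, j)] inside the block.
    Each shift kills one of them and creates none, as the fourth corner lies on neither line. Entry
    [(i, j)] grows while the others on its lines do not, so it stays dominant. *)
Lemma isolate_max_entry {R : realType} {m n : nat} {p : 'I_m -> R} {q : 'I_n -> R}
    (Psi : 'M[R]_(m, n) -> R) (I : {set 'I_m}) (J : {set 'I_n}) (i : 'I_m) (j : 'I_n)
    (P : 'M[R]_(m, n)) :
  (forall x y, transport p q x -> transport p q y ->
     strictly_majorized (entries x) (entries y) -> Psi y < Psi x) ->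
  transport p q P -> i \in I -> j \in J ->
  (forall l, l \in J -> P i l <= P i j) -> (forall k, k \in I -> P k j <= P i j) ->
  exists Q, [/\ transport p q Q, Q = P \/ Psi Q < Psi P,
    forall k l, ~~ ((k \in I) && (l \in J)) -> Q k l = P k l &
    (forall l, l \in J -> l != j -> Q i l = 0) \/
    (forall k, k \in I -> k != i -> Q k j = 0)].
Proof.
move=> Hs tP iI jJ.
have [N] := ubnP (#|[set l in J | P i l != 0%R]| + #|[set k in I | P k j != 0%R]|)%N.
elim: N P tP => // N IH P tP; rewrite ltnS => leN maxr maxc.
case: (pickP [pred l | [&& l \in J, l != j & P i l != 0]]) => [j' /and3P[j'J jj x0]|none]; last first.
  exists P; split=> //; first by left.
  left => l lJ lj.
  by apply/eqP; have := none l; rewrite /= lJ lj /= => /negbFE.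
case: (pickP [pred k | [&& k \in I, k != i & P k j != 0]]) => [i' /and3P[i'I ii y0]|none]; last first.
  exists P; split=> //; first by left.
  right => k kI ki.
  by apply/eqP; have := none k; rewrite /= kI ki /= => /negbFE.
have P0 k l : 0 <= P k l by case: tP.
have x1 : 0 < P i j' by rewrite lt_def x0 P0.
have y1 : 0 < P i' j by rewrite lt_def y0 P0.
have [] := shift_strictly_majorizes i i' j j' tP ii jj (maxr _ j'J) (maxc _ i'I) x1 y1.
set c := Num.min _ _; set Q := P + _ => tQ maj.
have ltQ := Hs _ _ tP tQ maj.
have c0 : 0 < c by rewrite lt_min x1.
have [[Qa Qx Qy _] [Qrow Qcol]] := add_square_cycle P c ii jj.
rewrite -/Q in Qa Qx Qy Qrow Qcol.
have Qil l : l != j -> Q i l = if l == j' then P i j' - c else P i l.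
  by move=> lj; case: eqVneq => [->//|lj']; exact: Qcol.
have Qkj k : k != i -> Q k j = if k == i' then P i' j - c else P k j.
  by move=> ki; case: eqVneq => [->//|ki']; exact: Qrow.
have a0 : P i j != 0 by rewrite gt_eqF // (lt_le_trans x1) // maxr.
have subr : [set l in J | Q i l != 0] \subset [set l in J | P i l != 0].
  apply/subsetP => l; rewrite !inE => /andP[-> /=].
  have [->|lj] := eqVneq l j; first by rewrite a0.
  by rewrite Qil //; case: (eqVneq l j') => [->|] //; rewrite x0.
have subc : [set k in I | Q k j != 0] \subset [set k in I | P k j != 0].
  apply/subsetP => k; rewrite !inE => /andP[-> /=].
  have [->|ki] := eqVneq k i; first by rewrite a0.
  by rewrite Qkj //; case: (eqVneq k i') => [->|] //; rewrite y0.
have dec : (#|[set l in J | Q i l != 0%R]| + #|[set k in I | Q k j != 0%R]| < N)%N.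
  have [cx|cy] : c = P i j' \/ c = P i' j by rewrite /c; case: leP; [left|right].
  - have : [set l in J | Q i l != 0] \proper [set l in J | P i l != 0].
      rewrite properE subr; apply/subsetPn; exists j'; rewrite !inE ?j'J ?x0 //.
      by rewrite Qx cx subrr eqxx.
    by move=> /proper_card lt; apply: leq_trans (leq_add lt (subset_leq_card subc)) leN.
  - have : [set k in I | Q k j != 0] \proper [set k in I | P k j != 0].
      rewrite properE subc; apply/subsetPn; exists i'; rewrite !inE ?i'I ?y0 //.
      by rewrite Qy cy subrr eqxx.
    move=> /proper_card lt; apply: leq_trans leN; rewrite -addnS.
    exact: leq_add (subset_leq_card subr) lt.
have [||Q' [tQ' le' off' iso]] := IH Q tQ dec.
- move=> l lJ; have [->//|lj] := eqVneq l j.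
  by have := maxr l lJ; rewrite Qil // Qa; case: eqVneq => [->|]; lra.
- move=> k kI; have [->//|ki] := eqVneq k i.
  by have := maxc k kI; rewrite Qkj // Qa; case: eqVneq => [->|]; lra.
exists Q'; split=> //; first by right; case: le' => [->//|]; move/lt_trans; exact.
move=> k l kl; rewrite off' //.
(* Only rows [i] and [i'] change; a cell there outside the block has its column outside [J], hence
   different from [j] and [j']. *)
have [ki|ki] := boolP ((k == i) || (k == i')); last first.
  by move: ki; rewrite negb_or => /andP[]; exact: Qrow.
have kI : k \in I by case/orP: ki => /eqP->.
by rewrite kI /= in kl; apply: Qcol; apply: contraNneq kl => ->.
Qed.

(** Induction on the size of the block: the line on which its largest entry has been isolated is
    removed, and later shifts leave that line untouched. *)
Lemma cycle_free_minorant {R : realType} {m n : nat} {p : 'I_m -> R} {q : 'I_n -> R}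
    (Psi : 'M[R]_(m, n) -> R) (I : {set 'I_m}) (J : {set 'I_n}) (P : 'M[R]_(m, n)) :
  (forall x y, transport p q x -> transport p q y ->
     strictly_majorized (entries x) (entries y) -> Psi y < Psi x) ->
  transport p q P ->
  exists Q, [/\ transport p q Q, Q = P \/ Psi Q < Psi P,
    forall k l, ~~ ((k \in I) && (l \in J)) -> Q k l = P k l &
    @cycle_free R _ _ (support_mx Q :&: setX I J)].
Proof.
move=> Hs; have [N] := ubnP (#|I| + #|J|)%N.
elim: N I J P => // N IH I J P leN tP.
case: (pickP [pred u : 'I_m * 'I_n | (u.1 \in I) && (u.2 \in J)]) => [u0 u0P|none]; last first.
  exists P; split=> //; first by left.
  move=> D _ sD; apply/matrixP => k l; rewrite mxE; apply/eqP; apply: contraT => /sD.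
  by have := none (k, l); rewrite /= !inE => -> /=; rewrite andbF.
have [[i j] /= /andP[iI jJ] mx] := @arg_maxP _ _ _ u0 _ (fun u => P u.1 u.2) u0P.
have [||Q [tQ leQ offQ iso]] := @isolate_max_entry _ _ _ p q Psi I J i j P Hs tP iI jJ.
- by move=> l lJ; apply: (mx (i, l)); rewrite /= iI.
- by move=> k kI; apply: (mx (k, j)); rewrite /= kI.
have trans Q' : Q' = Q \/ Psi Q' < Psi Q -> Q' = P \/ Psi Q' < Psi P.
  case=> [->//|lt]; right; case: leQ => [<-//|]; exact: lt_trans.
case: iso => iso.
- have [|Q' [tQ' leQ' offQ' cf]] := IH (I :\ i) J Q _ tQ.
    by move: leN; rewrite (cardsD1 i I) iI.
  exists Q'; split=> //; first exact: trans.
    move=> k l kl; rewrite offQ' ?offQ // !inE; apply: contraNN kl.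
    by case/andP=> /andP[_ ->].
  move=> D mD sD.
  (* [Q'] agrees with [Q] on row [i], so [D] can be nonzero there only at [(i, j)], and the
     vanishing row sum excludes that too. Hence [D] lives on the smaller block. *)
  have Dil l : l != j -> D i l = 0.
    move=> lj; apply/eqP; apply: contraT => /sD; rewrite !inE /= => /and3P[Q'il _ lJ].
    by rewrite offQ' ?iso ?eqxx // !inE eqxx in Q'il.
  have Dij : D i j = 0.
    have := mD.1 i; rewrite (bigD1 j) //= big1 ?addr0 // => l; exact: Dil.
  apply: cf => // k l Dkl; have := sD _ _ Dkl; rewrite !inE /= => /and3P[-> -> ->].
  rewrite !andbT /=; apply: contraNneq Dkl => ->.
  by have [->|/Dil ->] := eqVneq l j; rewrite ?Dij.
- have [|Q' [tQ' leQ' offQ' cf]] := IH I (J :\ j) Q _ tQ.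
    by move: leN; rewrite (cardsD1 j J) jJ addnS.
  exists Q'; split=> //; first exact: trans.
    move=> k l kl; rewrite offQ' ?offQ // !inE; apply: contraNN kl.
    by case/andP=> -> /andP[_ ->].
  move=> D mD sD.
  have Dkj k : k != i -> D k j = 0.
    move=> ki; apply/eqP; apply: contraT => /sD; rewrite !inE /= => /and3P[Q'kj kI _].
    by rewrite offQ' ?iso ?eqxx // !inE eqxx andbF in Q'kj.
  have Dij : D i j = 0.
    have := mD.2 j; rewrite (bigD1 i) //= big1 ?addr0 // => k; exact: Dkj.
  apply: cf => // k l Dkl; have := sD _ _ Dkl; rewrite !inE /= => /and3P[-> -> ->].
  rewrite !andbT /=; apply: contraNneq Dkl => ->.
  by have [->|/Dkj ->] := eqVneq k i; rewrite ?Dij.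
Qed.

(** * The incidence matrix and its rank *)

(** Unsigned edge-vertex incidence matrix of the bipartite graph whose vertices are the rows and
    columns and whose edges are the cells of [T]. *)
Definition incidence (R : realType) {m n : nat} (T : {set 'I_m * 'I_n}) : 'M[R]_(#|T|, m + n) :=
  \matrix_(k < #|T|) row_mx (delta_mx 0 (enum_val k).1) (delta_mx 0 (enum_val k).2).

Lemma incidenceEl {R : realType} {m n : nat} (T : {set 'I_m * 'I_n}) (k : 'I_#|T|) (i : 'I_m) :
  incidence R T k (lshift n i) = (i == (enum_val k).1)%:R.
Proof. by rewrite mxE row_mxEl mxE eqxx. Qed.

Lemma incidenceEr {R : realType} {m n : nat} (T : {set 'I_m * 'I_n}) (k : 'I_#|T|) (j : 'I_n) :
  incidence R T k (rshift m j) = (j == (enum_val k).2)%:R.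
Proof. by rewrite mxE row_mxEr mxE eqxx. Qed.

Lemma mul_tr_incidence {R : realType} {m n : nat} (T : {set 'I_m * 'I_n})
    (u : 'rV[R]_(m + n)) (k : 'I_#|T|) :
  (u *m (incidence R T)^T) 0 k =
  u 0 (lshift n (enum_val k).1) + u 0 (rshift m (enum_val k).2).
Proof.
rewrite mxE big_split_ord /=; congr (_ + _).
- rewrite (bigD1 (enum_val k).1) //= big1 => [|i /negbTE ik].
    by rewrite mxE incidenceEl eqxx mulr1 addr0.
  by rewrite mxE incidenceEl ik mulr0.
- rewrite (bigD1 (enum_val k).2) //= big1 => [|i /negbTE ik].
    by rewrite mxE incidenceEr eqxx mulr1 addr0.
  by rewrite mxE incidenceEr ik mulr0.
Qed.

(** Identifies the left kernel of the incidence matrix with the matrices on [T] whose margins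
    vanish. *)
Lemma mul_incidence {R : realType} {m n : nat} (T : {set 'I_m * 'I_n}) (D : 'M[R]_(m, n)) :
  (forall i j, D i j != 0 -> (i, j) \in T) ->
  \row_k D (enum_val k).1 (enum_val k).2 *m incidence R T =
  row_mx (\row_i \sum_j D i j) (\row_j \sum_i D i j).
Proof.
move=> sD.
have big_T (h : 'I_m * 'I_n -> R) :
    \sum_(k < #|T|) D (enum_val k).1 (enum_val k).2 * h (enum_val k) =
    \sum_i \sum_j D i j * h (i, j).
  rewrite -(big_enum_val (fun w => D w.1 w.2 * h w)) pair_bigA /= big_mkcond /=.
  apply: eq_bigr => -[i j] _ /=; case: ifPn => // ijT.
  have [->|/sD] := eqVneq (D i j) 0; first by rewrite mul0r.
  by rewrite (negbTE ijT).
apply/rowP => l; rewrite mxE.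
case: (split_ordP l) => [i|j] ->; rewrite ?row_mxEl ?row_mxEr mxE.
- under eq_bigr do rewrite mxE incidenceEl.
  rewrite (big_T (fun w => (i == w.1)%:R)) (bigD1 i) //= [X in _ + X]big1 ?addr0 => [|k /negbTE ki].
    by apply: eq_bigr => j _; rewrite eqxx mulr1.
  by rewrite big1 // => j _; rewrite eq_sym ki mulr0.
- under eq_bigr do rewrite mxE incidenceEr.
  rewrite (big_T (fun w => (j == w.2)%:R)) exchange_big (bigD1 j) //= [X in _ + X]big1 ?addr0 => [|k /negbTE ki].
    by apply: eq_bigr => i _; rewrite eqxx mulr1.
  by rewrite big1 // => i _; rewrite eq_sym ki mulr0.
Qed.

Lemma row_free_incidence {R : realType} {m n : nat} (T : {set 'I_m * 'I_n}) :
  row_free (incidence R T) <-> @cycle_free R _ _ T.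
Proof.
split=> [fr D [Dr Dc] sD|cf].
- have /eqP := mul_incidence T D sD.
  have -> : row_mx (\row_i \sum_j D i j) (\row_j \sum_i D i j) = 0.
    by rewrite -row_mx0; congr row_mx; apply/rowP => k; rewrite !mxE ?Dr ?Dc.
  rewrite mulmx_free_eq0 // => /eqP /rowP u0.
  apply/matrixP => i j; rewrite mxE; apply/eqP; apply: contraT => Dij.
  have ijT := sD _ _ Dij; have := u0 (enum_rank_in ijT (i, j)).
  by rewrite !mxE enum_rankK_in //= => e; rewrite e eqxx in Dij.
- apply: inj_row_free => u u0.
  (* Puts the coefficients of [u] back on their cells: the sum has one term on a cell of [T] and
     none elsewhere. *)
  pose D : 'M[R]_(m, n) := \matrix_(i, j) \sum_(k | enum_val k == (i, j) :> _ * _) u 0 k.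
  have sD i j : D i j != 0 -> (i, j) \in T.
    rewrite mxE; apply: contraNT => ijT; rewrite big_pred0 // => k.
    by apply: contraNF ijT => /eqP <-; exact: enum_valP.
  have Du : \row_k D (enum_val k).1 (enum_val k).2 = u.
    apply/rowP => k; rewrite !mxE (big_pred1 k) // => l.
    by rewrite /= -surjective_pairing (inj_eq enum_val_inj).
  have := mul_incidence T D sD; rewrite Du u0 -row_mx0 => /esym/eq_row_mx[/rowP r0 /rowP c0].
  have D0 : D = 0.
    by apply: cf => //; split=> k; [have := r0 k | have := c0 k]; rewrite !mxE.
  by rewrite -Du D0; apply/rowP => k; rewrite !mxE.
Qed.

(** Dual form of the statement that the vectors [e_i + f_j] with [(i, j)] in [T] span all of them;
    [f] and [g] are the coordinates of a linear functional. *)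
Definition spanning (R : realType) {m n : nat} (T : {set 'I_m * 'I_n}) : Prop :=
  forall (f : 'I_m -> R) (g : 'I_n -> R),
    (forall u, u \in T -> f u.1 + g u.2 = 0) -> forall i j, f i + g j = 0.

(** The kernel of the transpose is the line through the vector equal to 1 on rows and -1 on
    columns. *)
Lemma rank_incidence {R : realType} {m n : nat} (T : {set 'I_m * 'I_n}) :
  (0 < m)%N -> (0 < n)%N -> spanning R T -> \rank (incidence R T) = (m + n).-1.
Proof.
move=> m0 n0 sp; pose v : 'rV[R]_(m + n) := row_mx (const_mx 1) (const_mx (-1)).
have v0 : v != 0.
  apply/eqP => /rowP /(_ (lshift n (Ordinal m0))); rewrite row_mxEl !mxE.
  by apply/eqP; rewrite oner_eq0.
have ker : (kermx (incidence R T)^T == v)%MS.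
  apply/rV_eqP => u; apply/sub_kermxP/sub_rVP => [u0|[a ->]]; last first.
    apply/rowP => k; rewrite mul_tr_incidence [RHS]mxE 2![fun_of_matrix (_ *: _) _ _]mxE -mulrDr.
    by rewrite row_mxEl row_mxEr !mxE subrr mulr0.
  have fg := sp (fun i => u 0 (lshift n i)) (fun j => u 0 (rshift m j)) _.
  have {}fg i j : u 0 (lshift n i) + u 0 (rshift m j) = 0.
    apply: fg => w wT; have := mul_tr_incidence T u (enum_rank_in wT w).
    by rewrite u0 mxE enum_rankK_in.
  exists (u 0 (lshift n (Ordinal m0))); apply/rowP => l; rewrite mxE.
  case: (split_ordP l) => [i|j] ->; rewrite ?row_mxEl ?row_mxEr mxE.
    rewrite mulr1; apply: (addIr (u 0 (rshift m (Ordinal n0)))).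
    by rewrite !fg.
  by rewrite mulrN1; apply/eqP; rewrite -subr_eq0 opprK addrC fg.
have := eqmx_rank ker; rewrite mxrank_ker mxrank_tr rank_rV v0 /=.
by have := rank_leq_col (incidence R T); lia.
Qed.

(** * Circuits, connectedness and spanning sets *)

(* With [s k] the sign, [s (k + 1) = r (k + 1) - r k], so the sum is cyclically
   telescoped to that of [r k * (h k - h (k + 1))]. *)
Lemma sum_alternating {R : realType} {N : nat} (r : 'I_N -> bool) (h : 'I_N -> R) :
  (forall k, r (ordS k) = ~~ r k) -> (forall k, r k -> h (ordS k) = h k) ->
  \sum_k (if r k then 1 else -1) * h k = 0.
Proof.
move=> alt hr; rewrite (reindex_inj (@ordS_inj N)) /=.
transitivity (\sum_k (r (ordS k))%:R * h (ordS k) - \sum_k (r k)%:R * h (ordS k)).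
  rewrite -sumrB; apply: eq_bigr => k _.
  by rewrite -mulrBl alt; case: (r k); rewrite /= ?subr0 ?sub0r.
rewrite -(reindex_inj (@ordS_inj N) (P := predT) (F := fun k => (r k)%:R * h k)) /= -sumrB.
apply: big1 => k _; rewrite -mulrBr; case: (boolP (r k)) => [/hr ->|_].
  by rewrite subrr mulr0.
by rewrite mul0r.
Qed.

Lemma sum_delta_fst {R : realType} {I J : finType} (w : I * J) (i : I) :
  \sum_j (w == (i, j))%:R = (w.1 == i)%:R :> R.
Proof.
case: w => a b; rewrite (bigD1 b) //= xpair_eqE eqxx andbT big1 ?addr0 // => j /negbTE jb.
by rewrite xpair_eqE [b == j]eq_sym jb andbF.
Qed.

Lemma sum_delta_snd {R : realType} {I J : finType} (w : I * J) (j : J) :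
  \sum_i (w == (i, j))%:R = (w.2 == j)%:R :> R.
Proof.
case: w => a b; rewrite (bigD1 a) //= xpair_eqE eqxx big1 ?addr0 // => i /negbTE ia.
by rewrite xpair_eqE [a == i]eq_sym ia.
Qed.

(** Alternating signs along a circuit define a nonzero matrix with vanishing margins. *)
Lemma cycle_free_no_circuit (R : realType) {m n : nat} (T : {set 'I_m * 'I_n}) :
  @cycle_free R _ _ T -> ~ (exists N v, circuit_in T N v).
Proof.
move=> cf [N [v [N4 vT vinj vadj vstep]]].
pose w (k : 'I_N) := v k.
have wS k : adjacent (w k) (w (ordS k)) by rewrite /w /= -addn1; exact: vadj.
have wSS (k : 'I_N) : ((w (ordS (ordS k))).1 != (w k).1) /\ ((w (ordS (ordS k))).2 != (w k).2).
  have e : (ordS (ordS k) = (k + 2) %% N :> nat)%N.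
    by rewrite /= -[X in (X %% N)%N = _]addn1 modnDml addn1 addn2.
  by have := vstep k (ltn_ord k); rewrite -e.
have winj : injective w by move=> k l /vinj e; apply: val_inj; apply: e.
(* [r k] marks a step within a row. Two successive steps of the same kind would give cells [k] and
   [k + 2] a common line, which a circuit forbids. *)
pose r k := (w k).1 == (w (ordS k)).1.
have rN k : ~~ r k -> (w k).2 = (w (ordS k)).2.
  by move=> rk; case/andP: (wS k) => _; rewrite -/(r k) (negbTE rk) => /eqP.
have alt k : r (ordS k) = ~~ r k.
  have [e1 e2] := wSS k; case: (boolP (r k)) => rk /=.
    by apply/negbTE; apply: contra e1 => /eqP <-; rewrite eq_sym.
  by apply: contraT => /rN e; rewrite -e -(rN _ rk) eqxx in e2.
pose D : 'M[R]_(m, n) := \matrix_(i, j) \sum_k (if r k then 1 else -1) * (w k == (i, j))%:R.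
have D0 : D = 0.
  apply: cf; last first.
    move=> i j; rewrite mxE; apply: contraNT => ijT; rewrite big1 // => k _.
    case: eqP => [e|]; last by rewrite mulr0.
    by rewrite -e vT in ijT.
  split=> [i|j].
  - under eq_bigr do rewrite mxE.
    rewrite exchange_big /= -[RHS](@sum_alternating _ _ r (fun k => ((w k).1 == i)%:R) alt).
      by apply: eq_bigr => k _; rewrite -mulr_sumr sum_delta_fst.
    by move=> k /eqP ->.
  - under eq_bigr do rewrite mxE.
    rewrite exchange_big /= -[RHS]oppr0.
    (* The column is constant along the steps where [r] is false, so the alternating sum is taken
       with all signs reversed. *)
    rewrite -[X in _ = - X](@sum_alternating _ _ (fun k => ~~ r k) (fun k => ((w k).2 == j)%:R)); last 2 first.
    + by move=> k; rewrite alt.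
    + by move=> k /rN ->.
    rewrite -sumrN; apply: eq_bigr => k _; rewrite -mulr_sumr sum_delta_snd -mulNr.
    by case: (r k); rewrite /= ?opprK.
have N0 : (0 < N)%N by lia.
have /matrixP /(_ (w (Ordinal N0)).1 (w (Ordinal N0)).2) := D0.
rewrite !mxE -surjective_pairing (bigD1 (Ordinal N0)) //= eqxx big1 => [|k k0].
  by rewrite mulr1 addr0; case: ifP => _ /eqP; rewrite ?oppr_eq0 oner_eq0.
by rewrite (inj_eq winj) (negbTE k0) mulr0.
Qed.

(** Adjacent cells of [T] have equal [f]: either they share the row, or they share the column and
    [f] equals [- g] at both. By connectedness [f] is constant. *)
Lemma connected_spanning (R : realType) {m n : nat} (T : {set 'I_m * 'I_n}) :
  (0 < m)%N -> (forall i, exists j, (i, j) \in T) -> (forall j, exists i, (i, j) \in T) ->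
  connected_set T -> spanning R T.
Proof.
move=> m0 cr cc conn f g fg.
have along s u : u \in T -> path (@adjacent m n) u s -> all (fun x => x \in T) s ->
    f (last u s).1 = f u.1.
  elim: s u => //= x s IH u uT /andP[/andP[_ ux] ps] /andP[xT sT].
  rewrite IH //; case/orP: ux => /eqP e; first by rewrite e.
  by apply: (addIr (g x.2)); rewrite fg // -e fg.
have [j0 u0T] := cr (Ordinal m0).
have fc u : u \in T -> f u.1 = f (Ordinal m0).
  move=> uT; have [s [ps sT <-]] := conn _ _ u0T uT.
  by rewrite (along s _ u0T).
move=> i j; have [l /fc /= ->] := cr i; have [k kT] := cc j.
by rewrite -(fc _ kT); exact: (fg _ kT).
Qed.

(** Test functions: 1 on the rows and -1 on the columns met by the cells reachable from [u]. They
    cancel on [T], so by spanning the column of [v] is met, and [v] is reachable. *)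
Lemma spanning_connected (R : realType) {m n : nat} (T : {set 'I_m * 'I_n}) :
  spanning R T -> connected_set T.
Proof.
move=> sp u v uT vT.
pose C w := exists s, [/\ path (@adjacent m n) u s, all (fun x => x \in T) s & last u s = w].
have ext w x : C w -> x \in T -> (w.1 == x.1) || (w.2 == x.2) -> C x.
  move=> [s [ps sT lw]] xT wx; have [<-|nwx] := eqVneq w x; first by exists s.
  exists (rcons s x); rewrite rcons_path all_rcons last_rcons ps sT lw xT.
  by split=> //; rewrite /adjacent nwx.
pose f i : R := if `[< exists2 w, C w & w.1 = i >] then 1 else 0.
pose g j : R := if `[< exists2 w, C w & w.2 = j >] then -1 else 0.
have := sp f g _ u.1 v.2.
have Cu : C u by exists [::].
have -> : f u.1 = 1 by rewrite /f asboolT //; exists u.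
rewrite /g; case: asboolP => [[w Cw wv] _|_].
  by apply: (ext w) => //; rewrite wv eqxx orbT.
rewrite addr0 => fg; suff /fg/eqP : forall w, w \in T -> f w.1 + g w.2 = 0.
  by rewrite oner_eq0.
move=> w wT; rewrite /f /g; case: asboolP => [[x Cx xw]|nf]; case: asboolP => [[y Cy yw]|ng].
- by rewrite subrr.
- by case: ng; exists w => //; apply: (ext x) => //; rewrite xw eqxx.
- by case: nf; exists w => //; apply: (ext y) => //; rewrite yw eqxx orbT.
- by rewrite addr0.
Qed.

Lemma maximal_cycle_free_spanning (R : realType) {m n : nat} (T : {set 'I_m * 'I_n}) :
  maxset (fun S => row_free (incidence R S)) T -> spanning R T.
Proof.
move=> /maxsetP[/row_free_incidence cf mx] f g fg i j.
have [ijT|ijT] := boolP ((i, j) \in T); first exact: (fg _ ijT).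
have : ~ @cycle_free R _ _ ((i, j) |: T).
  move=> /row_free_incidence /mx /(_ (subsetUr _ _)) e.
  by rewrite -e setU11 in ijT.
move=> ncf; apply/eqP; apply: contraT => fij; case: ncf => D mD sD; apply: cf => //.
(* Vanishing margins make [D] orthogonal to [f k + g l]. Only the term at [(i, j)] can survive, so
   [D i j = 0] and [D] is supported in [T]. *)
have : \sum_k \sum_l D k l * (f k + g l) = 0.
  under eq_bigr do (under eq_bigr do rewrite mulrDr).
  under eq_bigr do rewrite big_split.
  rewrite big_split /= big1 => [|k _]; last by rewrite -mulr_suml mD.1 mul0r.
  by rewrite exchange_big big1 ?addr0 // => l _; rewrite -mulr_suml mD.2 mul0r.
rewrite pair_bigA (bigD1 (i, j)) //= big1 => [|[k l] /= kl]; last first.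
  have [->|/sD] := eqVneq (D k l) 0; first by rewrite mul0r.
  by rewrite in_setU1 (negbTE kl) => /fg /= ->; rewrite mulr0.
rewrite addr0 => /eqP; rewrite mulf_eq0 (negbTE fij) orbF => /eqP Dij k l Dkl.
by have := sD _ _ Dkl; rewrite in_setU1 => /orP[/eqP[ek el]|//]; rewrite ek el Dij eqxx in Dkl.
Qed.

(** * Extreme points and tree-supported matrices *)

Lemma in_support_mx {R : realType} {m n : nat} (P : 'M[R]_(m, n)) i j :
  ((i, j) \in support_mx P) = (P i j != 0).
Proof. by rewrite inE. Qed.

Lemma transport_sub {R : realType} {m n : nat} {p : 'I_m -> R} {q : 'I_n -> R}
    {A B : 'M[R]_(m, n)} :
  transport p q A -> transport p q B -> margins0 (A - B).
Proof.
move=> [_ [Ar Ac]] [_ [Br Bc]]; split=> k; under eq_bigr do rewrite !mxE.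
- by rewrite sumrB Ar Br subrr.
- by rewrite sumrB Ac Bc subrr.
Qed.

(** A nonzero [D] on the support would make [P] the midpoint of [P + e D] and [P - e D]. Conversely,
    where [P] vanishes so do both [A] and [B], hence [A - B] lives on the support. *)
Lemma extreme_point_cycle_free {R : realType} {m n : nat} {p : 'I_m -> R} {q : 'I_n -> R}
    (P : 'M[R]_(m, n)) :
  extreme_point p q P <-> transport p q P /\ @cycle_free R _ _ (support_mx P).
Proof.
split=> [[tP ext]|[tP cf]]; split=> //.
- move=> D mD sD; have P0 i j : 0 <= P i j by case: tP.
  (* Small enough that [P] absorbs [e D] with either sign; the default 1 keeps [e] positive when [D]
     is 0. *)
  pose e := \big[Num.min/1]_(w : 'I_m * 'I_n | D w.1 w.2 != 0) (P w.1 w.2 / `|D w.1 w.2|).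
  have e0 : 0 < e.
    apply: lt_bigmin => // -[i j] /= Dij.
    by rewrite divr_gt0 ?normr_gt0 // lt_def P0 -in_support_mx sD.
  have eD i j : e * `|D i j| <= P i j.
    have [->|Dij] := eqVneq (D i j) 0; first by rewrite normr0 mulr0.
    rewrite -ler_pdivlMr ?normr_gt0 //.
    exact: (@bigmin_le_cond _ _ _ 1 (i, j) _ (fun w => P w.1 w.2 / `|D w.1 w.2|)).
  have tr s : `|s| = e -> transport p q (P + s *: D).
    move=> se; apply: transport_add => // i j; rewrite !mxE.
    have := eD i j; rewrite -se -normrM -normrN => /(le_trans (ler_norm _)); lra.
  have half : 0 < (2^-1 : R) < 1 by apply/andP; lra.
  have := ext _ _ _ (tr e (gtr0_norm e0)) (tr (- e) _) half.
  rewrite normrN gtr0_norm // => /(_ erefl) eq.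
  have : P + e *: D = P + - e *: D.
    by apply: eq; apply/matrixP => i j; rewrite !mxE; field.
  move/addrI/eqP; rewrite -subr_eq0 scaleNr opprK -mulr2n -scaler_nat scalerA scaler_eq0.
  by rewrite mulf_eq0 pnatr_eq0 (gt_eqF e0) /= => /eqP.
- move=> A B t tA tB /andP[t0 t1] e; apply/eqP; rewrite -subr_eq0; apply/eqP.
  apply: cf; first exact: transport_sub tA tB.
  move=> i j; rewrite in_support_mx; apply: contraNneq => Pij.
  have A0 : 0 <= A i j by case: tA.
  have B0 : 0 <= B i j by case: tB.
  have : t * A i j + (1 - t) * B i j = 0 by rewrite -Pij e !mxE.
  have t1' : 0 < 1 - t by rewrite subr_gt0.
  move/eqP; rewrite paddr_eq0 ?mulr_ge0 ?(ltW t0) ?(ltW t1') // !mulf_eq0 (gt_eqF t0) (gt_eqF t1') /=.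
  by move=> /andP[/eqP Ae /eqP Be]; rewrite !mxE Ae Be subrr.
Qed.

(** Positive margins force [T] to meet every line, so a connected [T] has rank [m + n - 1], which is
    its cardinality. Conversely the support is extended to a maximal cycle-free set, whose rank
    gives its cardinality. *)
Lemma tree_supported_cycle_free {R : realType} {m n : nat} {p : 'I_m -> R} {q : 'I_n -> R}
    (P : 'M[R]_(m, n)) :
  (0 < m)%N -> (0 < n)%N -> (forall i, 0 < p i) -> (forall j, 0 < q j) ->
  tree_supported p q P <-> transport p q P /\ @cycle_free R _ _ (support_mx P).
Proof.
move=> m0 n0 p0 q0; split=> [[tP [T [PT [conn _] cT]]]|[tP cf]]; split=> //.
- have covr i : exists j, (i, j) \in T.
    apply: contrapT => none; have := p0 i; rewrite -(tP.2.1 i) big1 ?ltxx // => j _.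
    apply/eqP; apply: contraT => Pij; case: none; exists j.
    by apply: (subsetP PT); rewrite in_support_mx.
  have covc j : exists i, (i, j) \in T.
    apply: contrapT => none; have := q0 j; rewrite -(tP.2.2 j) big1 ?ltxx // => i _.
    apply/eqP; apply: contraT => Pij; case: none; exists i.
    by apply: (subsetP PT); rewrite in_support_mx.
  have sp := connected_spanning R T m0 covr covc conn.
  have /row_free_incidence cfT : row_free (incidence R T).
    by rewrite /row_free rank_incidence // cT.
  by move=> D mD sD; apply: cfT => // i j /sD; exact: (subsetP PT).
- move/row_free_incidence in cf.
  have [T mT PT] := @maxset_exists _ (fun S => row_free (incidence R S)) _ cf; exists T.
  have sp := maximal_cycle_free_spanning R T mT.
  have [fr _] := maxsetP mT.
  split=> //.
    split; first exact: spanning_connected sp.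
    by apply: (cycle_free_no_circuit R); apply/row_free_incidence.
  by apply/eqP; rewrite eq_sym -(rank_incidence T m0 n0 sp); exact: fr.
Qed.

(** * Existence and location of the minimum *)

(** The independent coupling shows that the polytope is not empty. *)
Lemma product_transport {R : realType} {m n : nat} (p : 'I_m -> R) (q : 'I_n -> R) :
  (forall i, 0 <= p i) -> \sum_i p i = 1 -> (forall j, 0 <= q j) -> \sum_j q j = 1 ->
  transport p q (\matrix_(i, j) (p i * q j)).
Proof.
move=> p0 p1 q0 q1; split=> [i j|]; first by rewrite mxE mulr_ge0.
split=> k; under eq_bigr do rewrite mxE.
- by rewrite -mulr_sumr q1 mulr1.
- by rewrite -mulr_suml p1 mul1r.
Qed.

(* A cycle-free transport matrix is determined by its support, so [Psi] takes
   only finitely many values on them. *)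
Lemma cycle_free_minimum {R : realType} {m n : nat} {p : 'I_m -> R} {q : 'I_n -> R}
    (Psi : 'M[R]_(m, n) -> R) (P1 : 'M[R]_(m, n)) :
  transport p q P1 -> @cycle_free R _ _ (support_mx P1) ->
  exists P0, (transport p q P0 /\ @cycle_free R _ _ (support_mx P0)) /\
    forall Q, transport p q Q -> @cycle_free R _ _ (support_mx Q) -> Psi P0 <= Psi Q.
Proof.
move=> tP1 cf1.
(* Minimality is restricted to supports in a list, so that the induction can run over an enumeration
   of all sets of cells. *)
suff [P0 [c0 min0]] : exists P0, (transport p q P0 /\ @cycle_free R _ _ (support_mx P0)) /\
    forall Q, transport p q Q -> @cycle_free R _ _ (support_mx Q) ->
      support_mx Q \in enum {: {set 'I_m * 'I_n}} -> Psi P0 <= Psi Q.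
  by exists P0; split=> // Q tQ cQ; apply: min0; rewrite ?mem_enum.
elim: (enum _) => [|S s [P0 [[t0 c0] min0]]]; first by exists P1.
have [[Q [tQ cQ sQ lt]]|none] := EM (exists Q, [/\ transport p q Q,
    @cycle_free R _ _ (support_mx Q), support_mx Q = S & Psi Q < Psi P0]).
  exists Q; split=> // Q' tQ' cQ'; rewrite inE => /orP[/eqP sQ'|/min0 le]; last first.
    by apply: le_trans (ltW lt) _; exact: le.
  suff -> : Q' = Q by [].
  apply/eqP; rewrite -subr_eq0; apply/eqP; apply: cQ; first exact: transport_sub tQ' tQ.
  move=> i j; rewrite !mxE; apply: contraNT => ij.
  have := ij; rewrite sQ -sQ' in_support_mx negbK => /eqP ->.
  by move: ij; rewrite in_support_mx negbK => /eqP ->; rewrite subrr.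
exists P0; split=> // Q tQ cQ; rewrite inE => /orP[/eqP sQ|]; last exact: min0.
by rewrite leNgt; apply/negP => lt; apply: none; exists Q.
Qed.

Theorem theorem4p1 (R : realType) (m n : nat) (p : 'I_m -> R) (q : 'I_n -> R)
  (Psi : 'M[R]_(m, n) -> R) :
  (2 <= m)%N -> (2 <= n)%N ->
  (forall i, 0 < p i) -> \sum_(i < m) p i = 1 ->
  (forall j, 0 < q j) -> \sum_(j < n) q j = 1 ->
  (* Psi symmetric in the entries (on C(p,q)) *)
  (forall (x : 'M[R]_(m, n)) (s : {perm 'I_m * 'I_n}),
     transport p q x -> transport p q (\matrix_(i, j) x (s (i, j)).1 (s (i, j)).2) ->
     Psi (\matrix_(i, j) x (s (i, j)).1 (s (i, j)).2) = Psi x) ->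
  (* Schur-concave on C(p,q) *)
  (forall x y, transport p q x -> transport p q y ->
     majorized (entries x) (entries y) -> Psi y <= Psi x) ->
  (* strict *)
  (forall x y, transport p q x -> transport p q y ->
     strictly_majorized (entries x) (entries y) -> Psi y < Psi x) ->
  [/\ (forall P, transport p q P ->
          (forall Q, transport p q Q -> Psi P <= Psi Q) -> tree_supported p q P),
      (exists P0, tree_supported p q P0 /\
          forall Q, transport p q Q -> Psi P0 <= Psi Q) &
      (forall P, tree_supported p q P <-> extreme_point p q P)].
Proof.
move=> m2 n2 p0 p1 q0 q1 _ _ strict.
have m0 : (0 < m)%N by exact: ltnW.
have n0 : (0 < n)%N by exact: ltnW.
have treeE P := tree_supported_cycle_free P m0 n0 p0 q0.
(* The block is the whole grid. A minimiser cannot be improved, so the descent returns it unchanged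
   and it is cycle-free. *)
have descent P : transport p q P -> exists Q,
    [/\ transport p q Q, Q = P \/ Psi Q < Psi P & @cycle_free R _ _ (support_mx Q)].
  move=> tP; have [Q [tQ leQ _ cf]] := cycle_free_minorant Psi setT setT P strict tP.
  exists Q; split=> // D mD sD; apply: cf => // i j /sD.
  by rewrite !inE !andbT.
split.
- move=> P tP minP; apply/treeE; have [Q [tQ [->|lt] cf]] := descent P tP; first by split.
  by have := minP Q tQ; rewrite leNgt lt.
- have tprod : transport p q (\matrix_(i, j) (p i * q j)).
    by apply: product_transport => // k; exact: ltW.
  have [P1 [t1 _ c1]] := descent _ tprod.
  have [P0 [c0 min0]] := cycle_free_minimum Psi P1 t1 c1.
  exists P0; split; first exact/treeE.
  move=> Q tQ; have [Q' [tQ' le cf]] := descent Q tQ.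
  apply: le_trans (min0 Q' tQ' cf) _.
  by case: le => [->|/ltW].
- by move=> P; split=> [/treeE/extreme_point_cycle_free|/extreme_point_cycle_free/treeE].
Qed.
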